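(* Let $k\ge1$, $m\ge0$, and let $\mathcal{C}_{\mathsf L}$ be a class of Kripke models all of which satisfy the frame condition $$\bigwedge_{i=1}^{m} w_i R o_i \to \exists y_1 \ldots \exists y_k \bigl(xRy_1 \wedge y_1Ry_2 \wedge \ldots \wedge y_{k-1}Ry_k\bigr).$$ Consider an instance of the monotelescopic rule $$\frac{\mathsf{x}R\mathsf{y}_1, \mathsf{y}_1R\mathsf{y}_2, \ldots, \mathsf{y}_{k-1}R\mathsf{y}_k, \mathsf{w}_1R\mathsf{o}_1, \ldots, \mathsf{w}_mR\mathsf{o}_m, \Gamma \Rightarrow \Delta}{\mathsf{w}_1R\mathsf{o}_1, \ldots, \mathsf{w}_mR\mathsf{o}_m, \Gamma \Rightarrow \Delta}$$ where $\mathsf x$ occurs in the conclusion sequent, none of the $\mathsf y_j$ occurs in the conclusion sequent, and the $\mathsf y_j$ are pairwise distinct. If the multiformula $$\mathop{\curlyvee}_{i=1}^{n}\Bigl(\mathop{\curlywedge}_{b=1}^{m_i}\mathsf{u}_{ib}:D_{ib}\ \curlywedge\ \mathop{\curlywedge}_{j=1}^{k}\mathsf{y}_j:C_{ij}\Bigr),$$ where no $\mathsf u_{ib}$ coincides with any $\mathsf y_j$, is an interpolant (w.r.t. $\mathcal{C}_{\mathsf L}$) of the premise, then $$\mathop{\curlyvee}_{i=1}^{n}\Bigl(\mathop{\curlywedge}_{b=1}^{m_i}\mathsf{u}_{ib}:D_{ib}\ \curlywedge\ \mathsf{x}:\Diamond\bigl(C_{i,1}\wedge\Diamond\bigl(C_{i,2}\wedge\Diamond(\ldots\wedge\Diamond(C_{i,k-1}\wedge\Diamond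 C_{ik})\ldots)\bigr)\bigr)\Bigr)$$ is an interpolant (w.r.t. $\mathcal{C}_{\mathsf L}$) of the conclusion.
   Context: Modal formulas are in negation normal form: built from positive atoms $P$, negative atoms $\overline{P}$, $\top,\bot$ by $\wedge,\vee,\Box,\Diamond$. Kripke models $\mathcal{M}=(W,R,V)$ and $\mathcal{M},w\Vdash A$ are standard. Fix a countable set $\mathsf W$ of labels. A labelled sequent $\Gamma\Rightarrow\Delta$ consists of a finite multiset $\Gamma$ of labelled formulas $\mathsf w:A$ and relational atoms $\mathsf wR\mathsf o$, and a finite multiset $\Delta$ of labelled formulas (relational atoms do not occur in consequents). An interpretation into $\mathcal{M}$ is a function $[\![\cdot]\!]:\mathsf W\to W$; it is a good $\mathcal{M}$-map on $\Gamma\Rightarrow\Delta$ if $[\![\mathsf w]\!]R[\![\mathsf o]\!]$ for each $\mathsf wR\mathsf o\in\Gamma$. $\mathcal{M}\vDash[\![\mathsf{Ant}(\Gamma)]\!]$ means $\mathcal{M},[\![\mathsf w]\!]\Vdash A$ for each $\mathsf w:A\in\Gamma$; $\mathcal{M}\vDash[\![\mathsf{Cons}(\Delta)]\!]$ means $\mathcal{M},[\![\mathsf o]\!]\Vdash B$ for some $\mathsf o:B\in\Delta$. Multiformulas are built from labelled formulas by external disjunction $\curlyvee$ and external conjunction $\curlywedge$ (written with an index range when iterated); $\mathcal{M}\vDash[\![\mathsf w:C]\!]$ iff $\mathcal{M},[\![\mathsf w]\!]\Vdash C$, and $\curlyvee,\curlywedge$ are interpreted classically. A multiformula $\mho$ is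 an interpolant of $\Gamma\Rightarrow\Delta$ w.r.t. a class $\mathcal{C}_{\mathsf L}$ of Kripke models if (1) each label in $\mho$ occurs in $\Gamma$ or in $\Delta$; (2) each positive atom $P$ in $\mho$ occurs both in $\Gamma$ and in $\Delta$; (3) each negative atom $\overline P$ in $\mho$ occurs both in $\Gamma$ and in $\Delta$; (4) for each $\mathcal{M}\in\mathcal{C}_{\mathsf L}$ and each good $\mathcal{M}$-map $[\![\cdot]\!]$ on $\Gamma\Rightarrow\Delta$: $\mathcal{M}\vDash[\![\mathsf{Ant}(\Gamma)]\!]$ implies $\mathcal{M}\vDash[\![\mho]\!]$, and $\mathcal{M}\vDash[\![\mho]\!]$ implies $\mathcal{M}\vDash[\![\mathsf{Cons}(\Delta)]\!]$. The frame condition is obtained from the rule by reading the labels $\mathsf w_i,\mathsf o_i,\mathsf x,\mathsf y_j$ (the $\mathsf w_i,\mathsf o_i,\mathsf x$ not necessarily distinct) as variables over worlds; it is universally closed over $w_i,o_i,x$. In the multiformulas, $n\ge1$ and $m_i\ge0$. *)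

(* Defs.v *)
From HB Require Import structures.
From mathcomp Require Import all_boot.
From mathcomp Require Import finmap multiset.

Set Implicit Arguments.
Unset Strict Implicit.
Unset Printing Implicit Defensive.

Local Open Scope mset_scope.

(* Modal formulas in negation normal form; [Neg P] is the negative atom. *)
Inductive form (atom : Type) : Type :=
| Pos of atom
| Neg of atom
| Top
| Bot
| And of form atom & form atom
| Or of form atom & form atom
| Box of form atom
| Dia of form atom.

Arguments Top {atom}.
Arguments Bot {atom}.

(* Formulas form a choiceType, so that multisets of them make sense. *)
Section FormChoice.
Variable atom : Type.

Fixpoint form_encode (A : form atom) : GenTree.tree atom :=
  match A with
  | Pos P => GenTree.Node 0 [:: GenTree.Leaf P]
  | Neg P => GenTree.Node 1 [:: GenTree.Leaf P]
  | Top => GenTree.Node 2 [::]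
  | Bot => GenTree.Node 3 [::]
  | And B C => GenTree.Node 4 [:: form_encode B; form_encode C]
  | Or B C => GenTree.Node 5 [:: form_encode B; form_encode C]
  | Box B => GenTree.Node 6 [:: form_encode B]
  | Dia B => GenTree.Node 7 [:: form_encode B]
  end.

Fixpoint form_decode (t : GenTree.tree atom) : option (form atom) :=
  match t with
  | GenTree.Node 0 [:: GenTree.Leaf P] => Some (Pos P)
  | GenTree.Node 1 [:: GenTree.Leaf P] => Some (Neg P)
  | GenTree.Node 2 [::] => Some Top
  | GenTree.Node 3 [::] => Some Bot
  | GenTree.Node 4 [:: t1; t2] =>
      if (form_decode t1, form_decode t2) is (Some B, Some C)
      then Some (And B C) else None
  | GenTree.Node 5 [:: t1; t2] =>
      if (form_decode t1, form_decode t2) is (Some B, Some C)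
      then Some (Or B C) else None
  | GenTree.Node 6 [:: t1] => omap (@Box atom) (form_decode t1)
  | GenTree.Node 7 [:: t1] => omap (@Dia atom) (form_decode t1)
  | _ => None
  end.

Lemma form_encodeK : pcancel form_encode form_decode.
Proof. by elim=> //= [B -> C ->|B -> C ->|B ->|B ->]. Qed.
End FormChoice.

HB.instance Definition _ (atom : choiceType) :=
  Choice.copy (form atom) (pcan_type (@form_encodeK atom)).

Fixpoint pos_atoms (atom : Type) (A : form atom) : seq atom :=
  match A with
  | Pos P => [:: P]
  | Neg _ | Top | Bot => [::]
  | And B C | Or B C => pos_atoms B ++ pos_atoms C
  | Box B | Dia B => pos_atoms B
  end.

Fixpoint neg_atoms (atom : Type) (A : form atom) : seq atom :=
  match A with
  | Neg P => [:: P]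
  | Pos _ | Top | Bot => [::]
  | And B C | Or B C => neg_atoms B ++ neg_atoms C
  | Box B | Dia B => neg_atoms B
  end.

Record kripke_model (atom : Type) := KripkeModel {
  world :> Type;
  world_inhabited : inhabited world;
  acc : world -> world -> Prop;
  valuation : atom -> world -> Prop
}.

Fixpoint forces (atom : Type) (M : kripke_model atom) (s : M) (A : form atom) :
    Prop :=
  match A with
  | Pos P => valuation P s
  | Neg P => ~ valuation P s
  | Top => True
  | Bot => False
  | And B C => forces s B /\ forces s C
  | Or B C => forces s B \/ forces s C
  | Box B => forall t : M, acc s t -> forces t B
  | Dia B => exists2 t : M, acc s t & forces t B
  end.

(* The pair (w, A) is the labelled formula w : A. *)
Notation lform label atom := (label * form atom)%type.

(* Antecedents also contain relational atoms; the pair (w, o) on the right of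
   the sum is the atom w R o. *)
Notation ant_item label atom := (lform label atom + label * label)%type.
Notation LForm w A := (inl (w, A)).
Notation RelAtom w o := (inr (w, o)).

Record sequent (label atom : choiceType) := Sequent {
  ant : {mset ant_item label atom};
  csq : {mset lform label atom}
}.

Section Occurrences.
Variables (label atom : choiceType).
Implicit Types (G : {mset ant_item label atom}) (D : {mset lform label atom}).

Definition label_in_ant (v : label) G : Prop :=
  (exists A : form atom, LForm v A \in G) \/
  (exists o : label, RelAtom v o \in G \/ RelAtom o v \in G).
Definition pos_in_ant (P : atom) G : Prop :=
  exists (v : label) (A : form atom), LForm v A \in G /\ P \in pos_atoms A.
Definition neg_in_ant (P : atom) G : Prop :=
  exists (v : label) (A : form atom), LForm v A \in G /\ P \in neg_atoms A.

Definition label_in_cons (v : label) D : Prop :=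
  exists A : form atom, (v, A) \in D.
Definition pos_in_cons (P : atom) D : Prop :=
  exists (v : label) (A : form atom), (v, A) \in D /\ P \in pos_atoms A.
Definition neg_in_cons (P : atom) D : Prop :=
  exists (v : label) (A : form atom), (v, A) \in D /\ P \in neg_atoms A.

Definition label_in (v : label) (S : sequent label atom) : Prop :=
  label_in_ant v (ant S) \/ label_in_cons v (csq S).
End Occurrences.

Section Semantics.
Variables (label atom : choiceType) (M : kripke_model atom) (I : label -> M).
Implicit Types (G : {mset ant_item label atom}) (D : {mset lform label atom}).

Definition good_map (S : sequent label atom) : Prop :=
  forall w o : label, RelAtom w o \in ant S -> acc (I w) (I o).
Definition sat_ant G : Prop :=
  forall (w : label) (A : form atom), LForm w A \in G -> forces (I w) A.
Definition sat_cons D : Prop :=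
  exists (o : label) (B : form atom), (o, B) \in D /\ forces (I o) B.
End Semantics.

(* Multiformulas: [MOr] and [MAnd] are the external connectives. *)
Inductive mform (label atom : Type) : Type :=
| MForm of label & form atom
| MOr of mform label atom & mform label atom
| MAnd of mform label atom & mform label atom.

Section Multiformulas.
Variables (label atom : Type).
Implicit Types F : mform label atom.

Fixpoint mlabels F : seq label :=
  match F with
  | MForm w _ => [:: w]
  | MOr F1 F2 | MAnd F1 F2 => mlabels F1 ++ mlabels F2
  end.

Fixpoint mpos_atoms F : seq atom :=
  match F with
  | MForm _ A => pos_atoms A
  | MOr F1 F2 | MAnd F1 F2 => mpos_atoms F1 ++ mpos_atoms F2
  end.

Fixpoint mneg_atoms F : seq atom :=
  match F with
  | MForm _ A => neg_atoms A
  | MOr F1 F2 | MAnd F1 F2 => mneg_atoms F1 ++ mneg_atoms F2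
  end.

Fixpoint msat (M : kripke_model atom) (I : label -> M) F : Prop :=
  match F with
  | MForm w A => forces (I w) A
  | MOr F1 F2 => msat I F1 \/ msat I F2
  | MAnd F1 F2 => msat I F1 /\ msat I F2
  end.

(* There is no empty external disjunction or conjunction: [mbig op f] is
   f_0 op (f_1 op (... op f_n)), with n + 1 >= 1 operands. *)
Fixpoint mbig (op : mform label atom -> mform label atom -> mform label atom)
    (n : nat) : ('I_n.+1 -> mform label atom) -> mform label atom :=
  match n return ('I_n.+1 -> mform label atom) -> mform label atom with
  | 0 => fun f => f ord0
  | _.+1 => fun f => op (f ord0) (mbig op (fun i => f (lift ord0 i)))
  end.

(* The external conjunction of f_0, ..., f_(m-1) with a final conjunct E;
   it is just E when m = 0. *)
Definition mand_before (m : nat) :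
    ('I_m -> mform label atom) -> mform label atom -> mform label atom :=
  match m return
    ('I_m -> mform label atom) -> mform label atom -> mform label atom with
  | 0 => fun _ E => E
  | _.+1 => fun f E => MAnd (mbig (@MAnd label atom) f) E
  end.
End Multiformulas.

Record interpolant (label atom : choiceType) (CL : kripke_model atom -> Prop)
    (S : sequent label atom) (F : mform label atom) : Prop := Interpolant {
  interpolant_labels : forall v : label, v \in mlabels F -> label_in v S;
  interpolant_pos : forall P : atom, P \in mpos_atoms F ->
    pos_in_ant P (ant S) /\ pos_in_cons P (csq S);
  interpolant_neg : forall P : atom, P \in mneg_atoms F ->
    neg_in_ant P (ant S) /\ neg_in_cons P (csq S);
  interpolant_sat : forall (M : kripke_model atom) (I : label -> M),
    CL M -> good_map I S ->
    (sat_ant I (ant S) -> msat I F) /\ (msat I F -> sat_cons I (csq S))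
}.

(* s R t_1, t_1 R t_2, ..., t_(k-1) R t_k for t = [:: t_1; ...; t_k]. *)
Fixpoint acc_chain (atom : Type) (M : kripke_model atom) (s : M) (t : seq M) :
    Prop :=
  if t is t1 :: t' then acc s t1 /\ acc_chain t1 t' else True.

(* The assignment I reads the labels w_i, o_i, x as variables over worlds, so
   coinciding labels receive the same world. *)
Definition frame_condition (label atom : Type) (m k : nat)
    (w o : 'I_m -> label) (x : label) (M : kripke_model atom) : Prop :=
  forall I : label -> M, (forall i, acc (I (w i)) (I (o i))) ->
  exists t : k.-tuple M, acc_chain (I x) t.

Section Monotelescopic.
Variables (label atom : choiceType).

Definition relatoms (m : nat) (w o : 'I_m -> label) :
    {mset ant_item label atom} :=
  seq_mset [seq RelAtom (w i) (o i) | i : 'I_m].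

(* x R y_1, y_1 R y_2, ..., y_(k-1) R y_k *)
Definition chain_relatoms (k : nat) (x : label) (y : 'I_k -> label) :
    {mset ant_item label atom} :=
  seq_mset (pairmap (fun a b => RelAtom a b) x (codom y)).

Definition monotelescopic_premise (m k : nat) (w o : 'I_m -> label) (x : label)
    (y : 'I_k -> label) (G : {mset ant_item label atom})
    (D : {mset lform label atom}) : sequent label atom :=
  Sequent (chain_relatoms x y `+` (relatoms w o `+` G)) D.

Definition monotelescopic_conclusion (m : nat) (w o : 'I_m -> label)
    (G : {mset ant_item label atom}) (D : {mset lform label atom}) :
    sequent label atom :=
  Sequent (relatoms w o `+` G) D.
End Monotelescopic.

(* Dia (C_0 /\ Dia (C_1 /\ ... /\ Dia (C_(k-1) /\ Dia C_k) ...)) *)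
Fixpoint dia_nest (atom : Type) (k : nat) : ('I_k.+1 -> form atom) -> form atom :=
  match k return ('I_k.+1 -> form atom) -> form atom with
  | 0 => fun C => Dia (C ord0)
  | _.+1 => fun C => Dia (And (C ord0) (dia_nest (fun j => C (lift ord0 j))))
  end.

(* Main.v *)
Require Import Defs.
From mathcomp Require Import all_boot.
From mathcomp Require Import finmap multiset.

(** The label x stands for the start of an R-chain through the y_j, and
    x : Dia (C_1 /\ Dia (C_2 /\ ...)) says precisely that the fresh labels y_j
    can be reinterpreted along some R-chain from x so that y_j : C_j for all j.
    If the antecedent of the conclusion holds, the frame condition supplies a
    chain; moving the y_j onto it gives a good map on the premise, hence the
    old interpolant, hence the new one. If the new interpolant holds, its
    diamonds supply the chain; moving the y_j onto it makes the old interpolant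
    true, hence the consequent, which does not mention the y_j. *)

Set Implicit Arguments.
Unset Strict Implicit.
Unset Printing Implicit Defensive.

Local Open Scope mset_scope.

Lemma existsb_ordS n (p : pred 'I_n.+1) :
  [exists i, p i] = p ord0 || [exists i, p (lift ord0 i)].
Proof.
apply/existsP/orP => [[i]|[p0|/existsP[i pi]]]; last by exists (lift ord0 i).
  by case: (unliftP ord0 i) => [j ->|-> ?]; [right; apply/existsP; exists j|left].
by exists ord0.
Qed.

Section Collected.
Variables (label atom : Type) (T : eqType).
Implicit Types (a : T) (c : mform label atom -> seq T).

(** Abstracting over the collector [c] lets one induction serve [mlabels], [mpos_atoms] and
    [mneg_atoms], which all turn an external connective into concatenation. *)
Lemma mem_mbig op c n (f : 'I_n.+1 -> mform label atom) a :
  (forall F1 F2, c (op F1 F2) = c F1 ++ c F2) ->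
  (a \in c (mbig op f)) = [exists i, a \in c (f i)].
Proof.
move=> c_op; elim: n f => [|n IHn] f /=; rewrite existsb_ordS.
  by case: existsP => [[[]]|]; rewrite ?orbF.
by rewrite c_op mem_cat IHn.
Qed.

Lemma mem_mand_before c n (f : 'I_n -> mform label atom) F a :
  (forall F1 F2, c (MAnd F1 F2) = c F1 ++ c F2) ->
  (a \in c (mand_before f F)) = [exists i, a \in c (f i)] || (a \in c F).
Proof.
move=> c_and; case: n f => [|n] f /=; first by case: existsP => [[[]]|].
by rewrite c_and mem_cat mem_mbig.
Qed.

(** Diamonds and conjunctions introduce no atoms, so trading the conjuncts [y j : C j] for one
    nested diamond formula preserves the atoms of either polarity. *)
Lemma mem_dia_nest (c : form atom -> seq T) k (C : 'I_k.+1 -> form atom) a :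
  (forall A B, c (And A B) = c A ++ c B) -> (forall A, c (Dia A) = c A) ->
  (a \in c (dia_nest C)) = [exists j, a \in c (C j)].
Proof.
move=> c_and c_dia; elim: k C => [|k IHk] C /=; rewrite existsb_ordS c_dia.
  by case: existsP => [[[]]|]; rewrite ?orbF.
by rewrite c_and mem_cat IHk.
Qed.
End Collected.

Section Satisfaction.
Variables (label atom : Type) (M : kripke_model atom) (I : label -> M).

Lemma msat_mbig_or n (f : 'I_n.+1 -> mform label atom) :
  msat I (mbig (@MOr label atom) f) <-> exists i, msat I (f i).
Proof.
elim: n f => [|n IHn] f /=.
  by split=> [|[i]]; [exists ord0 | rewrite (ord1 i)].
split=> [[f0|/IHn[i fi]]|[i]]; [by exists ord0 | by exists (lift ord0 i) |].
by case: (unliftP ord0 i) => [j ->|->] fi; [right; apply/IHn; exists j | left].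
Qed.

Lemma msat_mbig_and n (f : 'I_n.+1 -> mform label atom) :
  msat I (mbig (@MAnd label atom) f) <-> forall i, msat I (f i).
Proof.
elim: n f => [|n IHn] f /=; first by split=> [f0 i|]; rewrite ?(ord1 i).
split=> [[f0 /IHn fS] i|f_]; last by split=> //; apply/IHn.
by case: (unliftP ord0 i) => [j ->|->].
Qed.

Lemma msat_mand_before n (f : 'I_n -> mform label atom) F :
  msat I (mand_before f F) <-> (forall i, msat I (f i)) /\ msat I F.
Proof.
case: n f => [|n] f /=; first by split=> [|[]//]; split=> // -[].
by split=> -[] /msat_mbig_and.
Qed.

Lemma forces_dia_nest k (C : 'I_k.+1 -> form atom) (s : M) :
  forces s (dia_nest C) <->
  exists2 t : k.+1.-tuple M, acc_chain s t
    & forall j, forces (tnth t j) (C j).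
Proof.
elim: k C s => [|k IHk] C s /=.
  split=> [[t st Ct]|[t]].
    by exists [tuple t] => // j; rewrite (ord1 j).
  case/tupleP: t => t t' /= [st _] /(_ ord0).
  by rewrite tnth0; exists t.
split=> [[t st [Ct /IHk[t' tt' Ct']]]|[t]].
  exists [tuple of t :: t'] => // j.
  by case: (unliftP ord0 j) => [i ->|->]; rewrite ?tnthS ?tnth0.
case/tupleP: t => t t' /= [st tt'] Ct; exists t => //.
split; first by have := Ct ord0; rewrite tnth0.
by apply/IHk; exists t' => // j; have := Ct (lift ord0 j); rewrite tnthS.
Qed.
End Satisfaction.

Section Reassign.
Variables (label : eqType) (T : Type) (k : nat).
Variables (I : label -> T) (y : 'I_k -> label) (t : k.-tuple T).

(** The index found by [pick] is unambiguous once [y] is injective. *)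
Definition reassign (v : label) : T :=
  if [pick j | y j == v] is Some j then tnth t j else I v.

Lemma reassign_id v : (forall j, v <> y j) -> reassign v = I v.
Proof.
by rewrite /reassign => v_y; case: pickP => // j /eqP yj; case: (v_y j).
Qed.

Hypothesis y_inj : injective y.

Lemma reassign_at j : reassign (y j) = tnth t j.
Proof.
rewrite /reassign; case: pickP => [i /eqP/y_inj -> //|/(_ j)].
by rewrite eqxx.
Qed.

Lemma map_reassign : map reassign (codom y) = t.
Proof.
rewrite /codom /image_mem -map_comp -[RHS]map_tnth_enum.
by apply: eq_map => j; apply: reassign_at.
Qed.
End Reassign.

Section Chain.
Variables (label atom : choiceType).
Implicit Types (x a b : label) (s : seq label).

Local Notation chain x s :=
  (pairmap (fun a b => RelAtom a b : ant_item label atom) x s).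

Lemma acc_chain_pairmap (M : kripke_model atom) (I : label -> M) x s a b :
  acc_chain (I x) (map I s) -> RelAtom a b \in chain x s -> acc (I a) (I b).
Proof.
elim: s x => //= v s IHs x [xv vs]; rewrite inE.
by case/orP => [/eqP[-> ->] //|]; apply: IHs.
Qed.

Lemma pairmap_labels x s a b :
  RelAtom a b \in chain x s -> a \in x :: s /\ b \in x :: s.
Proof.
elim: s x => //= v s IHs x; rewrite inE.
case/orP => [/eqP[-> ->]|/IHs[a_in b_in]]; first by rewrite !inE !eqxx orbT.
by rewrite inE a_in inE b_in !orbT.
Qed.

Lemma lform_chain x s v (A : form atom) : (LForm v A \in chain x s) = false.
Proof. by elim: s x => //= u s IHs x; rewrite inE IHs. Qed.

Variables (m k : nat) (w o : 'I_m -> label) (x : label) (y : 'I_k -> label).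
Variables (G : {mset ant_item label atom}) (D : {mset lform label atom}).

Local Notation premise := (monotelescopic_premise w o x y G D).
Local Notation conclusion := (monotelescopic_conclusion w o G D).

Lemma mem_ant_premise z :
  (z \in ant premise) = (z \in chain x (codom y)) || (z \in ant conclusion).
Proof. by rewrite /= in_msetD (perm_mem (perm_eq_seq_mset _)). Qed.

(** The rule adds relational atoms only, so anything that depends just on the labelled formulas of
    the antecedent carries over. *)
Lemma lform_ant_premise v (A : form atom) :
  (LForm v A \in ant premise) = (LForm v A \in ant conclusion).
Proof. by rewrite mem_ant_premise lform_chain. Qed.

Lemma pos_in_ant_premise P :
  pos_in_ant P (ant premise) -> pos_in_ant P (ant conclusion).
Proof. by case=> v [A]; rewrite lform_ant_premise; exists v, A. Qed.

Lemma neg_in_ant_premise P :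
  neg_in_ant P (ant premise) -> neg_in_ant P (ant conclusion).
Proof. by case=> v [A]; rewrite lform_ant_premise; exists v, A. Qed.

(** The added chain atoms mention only [x], which already occurs in the conclusion, and the labels
    [y j], which are excluded. *)
Lemma label_in_premise v :
  label_in x conclusion -> (forall j, v <> y j) ->
  label_in v premise -> label_in v conclusion.
Proof.
move=> x_in v_y.
have v_chain : v \in x :: codom y -> label_in v conclusion.
  by rewrite inE => /predU1P[-> //|/codomP[j /v_y]].
case=> [[[A]|[a]]|]; last by right.
  by rewrite lform_ant_premise; left; left; exists A.
rewrite !mem_ant_premise.
case=> /orP[/pairmap_labels[*]|va]; try exact: v_chain.
  by left; right; exists a; left.
by left; right; exists a; right.
Qed.
End Chain.

Section Transfer.
Variables (label atom : choiceType) (M : kripke_model atom).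
Variables (I J : label -> M) (S : sequent label atom).
Hypothesis IJ : forall v, label_in v S -> I v = J v.

Lemma eq_good_map : good_map I S -> good_map J S.
Proof.
move=> gI v z vz.
have <- : I v = J v by apply: IJ; left; right; exists z; left.
have <- : I z = J z by apply: IJ; left; right; exists v; right.
exact: gI.
Qed.

Lemma eq_sat_ant : sat_ant I (ant S) -> sat_ant J (ant S).
Proof.
by move=> sI v A vA; rewrite -IJ; [apply: sI | left; left; exists A].
Qed.

Lemma eq_sat_cons : sat_cons I (csq S) -> sat_cons J (csq S).
Proof.
case=> v [A [vA sA]]; exists v, A; split=> //.
by rewrite -IJ //; right; exists A.
Qed.
End Transfer.

(* The k >= 1 labels y_j are indexed by 'I_k.+1 and the n >= 1 disjuncts by
   'I_n.+1. *)
Theorem theorem30 (label : countType) (atom : choiceType)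
    (CL : kripke_model atom -> Prop) (k m : nat)
    (w o : 'I_m -> label) (x : label) (y : 'I_k.+1 -> label)
    (G : {mset ant_item label atom}) (D : {mset lform label atom})
    (n : nat) (l : 'I_n.+1 -> nat)
    (u : forall i : 'I_n.+1, 'I_(l i) -> label)
    (E : forall i : 'I_n.+1, 'I_(l i) -> form atom)
    (C : 'I_n.+1 -> 'I_k.+1 -> form atom)
    (CL_frame : forall M : kripke_model atom,
        CL M -> frame_condition k.+1 w o x M)
    (x_occurs : label_in x (monotelescopic_conclusion w o G D))
    (y_fresh : forall j, ~ label_in (y j) (monotelescopic_conclusion w o G D))
    (y_inj : injective y)
    (u_neq_y : forall i b j, u i b <> y j) :
  interpolant CL (monotelescopic_premise w o x y G D)
    (mbig (@MOr label atom) (fun i =>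
       mand_before (fun b => MForm (u i b) (E i b))
                   (mbig (@MAnd label atom) (fun j => MForm (y j) (C i j))))) ->
  interpolant CL (monotelescopic_conclusion w o G D)
    (mbig (@MOr label atom) (fun i =>
       mand_before (fun b => MForm (u i b) (E i b))
                   (MForm x (dia_nest (C i))))).
Proof.
case=> labP posP negP satP.
have y_neq v j : label_in v (monotelescopic_conclusion w o G D) -> v <> y j.
  by move=> v_in vy; apply: (y_fresh j); rewrite -vy.
split.
- move=> v; rewrite mem_mbig // => /existsP[i].
  rewrite mem_mand_before // => /orP[/existsP[b v_ib]|]; last first.
    by rewrite inE => /eqP ->.
  apply: (label_in_premise x_occurs) => [j|].
    by move: v_ib; rewrite inE => /eqP ->; apply: u_neq_y.
  apply: labP; rewrite mem_mbig //; apply/existsP; exists i.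
  by rewrite mem_mand_before //; apply/orP; left; apply/existsP; exists b.
- move=> P; rewrite mem_mbig // => /existsP[i].
  (* After this rewriting, [P_i] says exactly that [P] occurs in the [i]-th disjunct of the old
     interpolant. *)
  rewrite mem_mand_before //= mem_dia_nest // => P_i.
  have [|P_ant P_cons] := posP P; last first.
    by split=> //; apply: pos_in_ant_premise P_ant.
  rewrite mem_mbig //; apply/existsP; exists i.
  by rewrite mem_mand_before // mem_mbig.
- move=> P; rewrite mem_mbig // => /existsP[i].
  rewrite mem_mand_before //= mem_dia_nest // => P_i.
  have [|P_ant P_cons] := negP P; last first.
    by split=> //; apply: neg_in_ant_premise P_ant.
  rewrite mem_mbig //; apply/existsP; exists i.
  by rewrite mem_mand_before // mem_mbig.
move=> M I CLM goodI.
have IJ (t : k.+1.-tuple M) v :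
    label_in v (monotelescopic_conclusion w o G D) -> I v = reassign I y t v.
  by move=> v_in; rewrite reassign_id // => j; apply: y_neq.
have goodJ (t : k.+1.-tuple M) : acc_chain (I x) t ->
    good_map (reassign I y t) (monotelescopic_premise w o x y G D).
  move=> xt a b; rewrite mem_ant_premise => /orP[|ab].
    (* The chain still starts at [I x]: since [x] occurs in the conclusion, it is not reassigned. *)
    by apply: acc_chain_pairmap; rewrite map_reassign // -IJ.
  exact: (eq_good_map (IJ t) goodI).
split=> [antI|/msat_mbig_or[i /msat_mand_before[uI]]].
  (* The frame condition is read under [I] itself; its hypotheses hold because the atoms [w i R o i]
     belong to the conclusion and [I] is good on it. *)
  have [|t xt] := CL_frame M CLM I.
    move=> i; apply: goodI; rewrite in_msetD (perm_mem (perm_eq_seq_mset _)).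
    by apply/orP; left; apply: codom_f.
  have [sat_ant_mf _] := satP M _ CLM (goodJ t xt).
  have [|i /msat_mand_before[uJ /msat_mbig_and yJ]] :=
    (msat_mbig_or _ _).1 (sat_ant_mf _).
    move=> v A; rewrite lform_ant_premise.
    exact: (eq_sat_ant (IJ t) antI).
  apply/msat_mbig_or; exists i; apply/msat_mand_before; split=> [b|].
    by have := uJ b; rewrite /= reassign_id //; apply: u_neq_y.
  apply/forces_dia_nest; exists t => // j.
  by have := yJ j; rewrite /= reassign_at.
move=> /forces_dia_nest[t xt Ct].
have [_ sat_mf_cons] := satP M _ CLM (goodJ t xt).
(* Premise and conclusion share [D]. The transfer back to [I] goes through the conclusion, because
   [IJ] covers only labels occurring there. *)
apply: (eq_sat_cons (I := reassign I y t)
  (S := monotelescopic_conclusion w o G D)) => [v /IJ //|].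
apply: sat_mf_cons; apply/msat_mbig_or; exists i.
apply/msat_mand_before; split=> [b|].
  by rewrite /= reassign_id; [apply: uI | apply: u_neq_y].
by apply/msat_mbig_and => j; rewrite /= reassign_at.
Qed.
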